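(* Let $F$ be the free monoid with basis $\{x,y,y',z,z'\}$, let $T$ be the right $F$-set defined in the context, and let $F[T]$ be the monoid constructed from this action. Then the monoid $F[T]$ does not admit a regular cross-section.
   Context: **Monoid from an action.** Let $M$ be a monoid acting from the right on a set $T$. The monoid $M[T]$ is the disjoint union $M\cup T$, with multiplication in $M$ as before and otherwise defined by $tm=t\cdot m$, $mt=t$, $ty=y$ for all $t,y\in T$, $m\in M$. This multiplication is associative. **The action.** $\mathbb{N}$ denotes the positive integers, and $\mathbb{B}=\{2^k : k\in\mathbb{N}\cup\{0\}\}$. Let $P=\{p_{\alpha,\beta} : \alpha\in\mathbb{N}\cup\{0\},\ \beta\in\mathbb{Z}\}$ (distinct symbols) and $T=P\cup\{\Omega\}$, where $\Omega\notin P$. The free monoid $F$ on $\{x,y,y',z,z'\}$ acts on $T$ from the right via the following action of its generators: - $p_{\alpha,\beta}\cdot x = p_{\alpha+1,0}$ if $\beta=0$, and $=\Omega$ if $\beta\neq 0$; - $p_{\alpha,\beta}\cdot y = p_{\alpha,\beta+1}$ if $\alpha\notin\mathbb{B}$; $=p_{\alpha,0}$ if $\alpha\in\mathbb{B}$ and $\beta=0$; $=\Omega$ if $\alpha\in\mathbb{B}$ and $\beta\neq0$; - $p_{\alpha,\beta}\cdot y' = p_{\alpha,\beta-1}$ if $\alpha\notin\mathbb{B}$; $=p_{\alpha,0}$ if $\alpha\in\mathbb{B}$ and $\beta=0$; $=\Omega$ if $\alpha\in\mathbb{B}$ and $\beta\neq0$; - $p_{\alpha,\beta}\cdot z = p_{\alpha,\beta}$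 if $\alpha\notin\mathbb{B}$, and $=p_{\alpha,\beta+1}$ if $\alpha\in\mathbb{B}$; - $p_{\alpha,\beta}\cdot z' = p_{\alpha,\beta}$ if $\alpha\notin\mathbb{B}$, and $=p_{\alpha,\beta-1}$ if $\alpha\in\mathbb{B}$; - $\Omega\cdot x=\Omega\cdot y=\Omega\cdot y'=\Omega\cdot z=\Omega\cdot z'=\Omega$. **Cross-sections.** A cross-section for a monoid $N$ is a language $L\subseteq A^*$ over some generating set $A$ for $N$ (elements of $A$ being viewed as letters; for regular languages $A$ is finite) such that every element of $N$ is represented by exactly one word in $L$. It is regular if $L$ is a regular language. To admit a regular cross-section means that one exists over some finite generating set. *)

(* Defs.v *)
From HB Require Import structures.
From mathcomp Require Import all_boot all_order all_algebra.
From mathcomp Require Import finmap.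

Set Implicit Arguments.
Unset Strict Implicit.
Unset Printing Implicit Defensive.

Section MonoidFromAction.

Record raction (M : monoidType) (T : Type) := RAction {
  ract :> T -> M -> T;
  ract1 : forall t, ract t 1%g = t;
  ractM : forall t m n, ract t (m * n)%g = ract (ract t m) n }.

(* The monoid M[T]: the disjoint union of M and T. *)
Definition adjoin_act (M : monoidType) (T : choiceType) (to : raction M T)
  : Type := (M + T)%type.

Variables (M : monoidType) (T : choiceType) (to : raction M T).

Definition adjoin_mul (u v : adjoin_act to) : adjoin_act to :=
  match u, v with
  | inl m, inl n => inl (m * n)%g
  | inr t, inl m => inr (to t m)
  | inl _, inr t => inr t
  | inr _, inr y => inr y
  end.

Definition adjoin_one : adjoin_act to := inl 1%g.

Fact adjoin_mulA : associative adjoin_mul.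
Proof. by case=> [m|t] [n|u] [p|v] //=; rewrite ?mulgA ?ractM. Qed.

Fact adjoin_mul1 : left_id adjoin_one adjoin_mul.
Proof. by case=> [m|t] //=; rewrite mul1g. Qed.

Fact adjoin_mulr1 : right_id adjoin_one adjoin_mul.
Proof. by case=> [m|t] //=; rewrite ?mulg1 ?ract1. Qed.

HB.instance Definition _ := Choice.copy (adjoin_act to) (M + T)%type.
HB.instance Definition _ :=
  isMonoid.Build (adjoin_act to) adjoin_mulA adjoin_mul1 adjoin_mulr1.

End MonoidFromAction.

Section FreeMonoid.

Definition free_monoid (X : choiceType) : Type := seq X.

HB.instance Definition _ (X : choiceType) :=
  Choice.copy (free_monoid X) (seq X).
HB.instance Definition _ (X : choiceType) :=
  isMonoid.Build (free_monoid X) (@catA X) (@cat0s X) (@cats0 X).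

Variables (X : choiceType) (T : Type) (f : T -> X -> T).

Definition free_act (t : T) (w : free_monoid X) : T := foldl f t w.

Fact free_act1 t : free_act t 1%g = t.
Proof. by []. Qed.

Fact free_actM t (v w : free_monoid X) :
  free_act t (v * w)%g = free_act (free_act t v) w.
Proof. exact: foldl_cat. Qed.

Definition free_raction : raction (free_monoid X) T :=
  RAction free_act1 free_actM.

End FreeMonoid.

Section RegularLanguages.

Record dfa (A : finType) := Dfa {
  dfa_state : finType;
  dfa_init : dfa_state;
  dfa_final : {set dfa_state};
  dfa_trans : dfa_state -> A -> dfa_state }.

Definition dfa_accept (A : finType) (D : dfa A) (w : seq A) : bool :=
  foldl (@dfa_trans A D) (dfa_init D) w \in dfa_final D.

Definition language (A : Type) := seq A -> Prop.

Definition regular (A : finType) (L : language A) : Prop :=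
  exists D : dfa A, forall w, L w <-> dfa_accept D w.

End RegularLanguages.

Section CrossSections.

Variable N : monoidType.

(* The letters are the elements of the finite set [A] themselves. *)
Definition word_value (A : {fset N}) (w : seq A) : N :=
  \big[*%g/1%g]_(a <- w) (val a).

Definition generates (A : {fset N}) : Prop :=
  forall n : N, exists w : seq A, word_value w = n.

Definition cross_section (A : {fset N}) (L : language A) : Prop :=
  forall n : N, exists! w : seq A, L w /\ word_value w = n.

Definition admits_regular_cross_section : Prop :=
  exists (A : {fset N}) (L : language A),
    [/\ generates A, regular L & cross_section L].

End CrossSections.

Inductive gen := gx | gy | gy' | gz | gz'.

Definition gen_code (g : gen) : 'I_5 :=
  inord (match g with gx => 0 | gy => 1 | gy' => 2 | gz => 3 | gz' => 4 end).

Definition gen_decode (i : 'I_5) : gen :=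
  match val i with 0 => gx | 1 => gy | 2 => gy' | 3 => gz | _ => gz' end.

Fact gen_codeK : cancel gen_code gen_decode.
Proof. by case; rewrite /gen_decode /= inordK. Qed.

HB.instance Definition _ := Finite.copy gen (can_type gen_codeK).

(* Bounding the exponent is harmless, as [k < 2 ^ k]; see [pow2P]. *)
Definition pow2 (a : nat) : bool := [exists k : 'I_a, a == 2 ^ k].

Lemma pow2P a : reflect (exists k, a = 2 ^ k) (pow2 a).
Proof.
apply: (iffP existsP) => [[k /eqP->]|[k ->]]; first by exists k.
by exists (Ordinal (ltn_expl k (isT : 1 < 2))).
Qed.

(* [Some (a, b)] is p_{a,b} and [None] is Omega. *)
Definition pT : choiceType := option (nat * int).

Definition gen_act (t : pT) (g : gen) : pT :=
  match t with
  | None => None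
  | Some (a, b) =>
    match g with
    | gx => if b == 0%R then Some (a.+1, 0%R) else None
    | gy => if ~~ pow2 a then Some (a, b + 1)%R
            else if b == 0%R then Some (a, 0%R) else None
    | gy' => if ~~ pow2 a then Some (a, b - 1)%R
             else if b == 0%R then Some (a, 0%R) else None
    | gz => if ~~ pow2 a then Some (a, b) else Some (a, b + 1)%R
    | gz' => if ~~ pow2 a then Some (a, b) else Some (a, b - 1)%R
    end
  end.

Definition F : monoidType := free_monoid gen.

Definition FT : monoidType := adjoin_act (free_raction gen_act : raction F pT).

(* Main.v *)
Require Import Defs.
From mathcomp Require Import all_boot all_order all_algebra.
From mathcomp Require Import finmap zify.

Set Implicit Arguments.
Unset Strict Implicit.
Unset Printing Implicit Defensive.

(** Given a regular cross-section, let [u t v] be the chosen word for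
p_{2^k,b}, where [t] is its last letter in T and [k], [b] are large.  Pumping on
the column gives [v = a c d] such that [c] is a loop of the automaton that moves
p_{2^k,i} to p_{2^k,j} with [i <> j].  If [c] kills p_{2^k,j}, then
[u t a c^2 d] and [u t a c^3 d] both represent Omega.  Otherwise [c] consists of
z's and z''s only, because every other generator kills all but one entry of row
2^k, and so [c] fixes all rows outside B.  Pumping on the row inside [a] gives
[a'], ending in the same state as [a], such that [t a'] is Omega or lies in a
row 2^k (1 + 2 m) with [0 < m]; hence [u t a' d] and [u t a' c d] have the same
value.  Either way uniqueness fails. *)

(** * Pumping along a quantity of bounded growth *)

Section Loops.

Variables (A : Type) (Q : finType) (V : Type).
Variables (step : Q -> A -> Q) (g : V -> A -> V) (mu : V -> nat) (l : nat).
Hypothesis mu_step : forall v a, mu (g v a) <= mu v + l.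

(** Pigeonhole on the first times at which [mu] passes the [#|Q|.+1] levels [K + r * l]: two of them
    share a state. A step adds at most [l], so each first passage stays at or below the next level,
    and [mu] is larger at the later one. *)
Lemma exists_growing_loop K q v w :
    mu v <= K -> K + #|Q| * l < mu (foldl g v w) ->
  exists a b d, [/\ w = a ++ b ++ d,
    foldl step q (a ++ b) = foldl step q a,
    K < mu (foldl g v a) & mu (foldl g v a) < mu (foldl g v (a ++ b))].
Proof.
move=> mu_v mu_w; pose m i := mu (foldl g v (take i w)).
have cross (r : 'I_#|Q|.+1) : exists i, [/\ K + r * l < m i,
    m i <= K + r.+1 * l & forall i', i' < i -> m i' <= K + r * l].
  have ex : exists i, K + r * l < m i.
    exists (size w); rewrite /m take_size; apply: leq_ltn_trans mu_w.
    by rewrite leq_add2l leq_mul2r -ltnS ltn_ord orbT.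
  case: (ex_minnP ex) => i mi min_i; exists i.
  have lt_i i' : i' < i -> m i' <= K + r * l.
    by move=> ii'; rewrite leqNgt; apply/negP => /min_i; rewrite leqNgt ii'.
  split=> //; case: i mi min_i lt_i => [|i] mi _ lt_i.
    (* No level is passed at time 0, since [mu v <= K]. *)
    by move: mi; rewrite /m take0 /=; lia.
  have /lt_i : i < i.+1 by [].
  have [lt_iw|le_wi] := ltnP i (size w); last first.
    by move: mi; rewrite /m !take_oversize //; lia.
  have [a0 _] : exists a0 : A, True by case: (w) lt_iw => // a0; exists a0.
  rewrite /m (take_nth a0) // foldl_rcons.
  by have := mu_step (foldl g v (take i w)) (nth a0 w i); rewrite /m; lia.
have [pos posP] := fin_all_exists cross.
have /injectivePn[r [r' ne eq_st]] :
    ~~ injectiveb (fun r => foldl step q (take (pos r) w)).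
  apply/injectiveP => inj; have := leq_card _ inj.
  by rewrite card_ord ltnn.
wlog lt_rr' : r r' ne eq_st / r < r'.
  move=> W; have [lt|gt|/val_inj eq] := ltngtP r r'; first exact: (W r r').
    by apply: (W r' r); rewrite // eq_sym.
  by rewrite eq eqxx in ne.
have [Kr mr _] := posP r; have [Kr' _ min_r'] := posP r'.
have le_r : r.+1 * l <= r' * l by rewrite leq_mul2r lt_rr' orbT.
have lt_m : m (pos r) < m (pos r') by lia.
have lt_pos : pos r <= pos r'.
  have [_ _ min_r] := posP r.
  by rewrite leqNgt; apply/negP => /min_r; lia.
have take_pos : take (pos r) w ++ drop (pos r) (take (pos r') w)
    = take (pos r') w.
  by rewrite -{1}(take_takel _ lt_pos) cat_take_drop.
exists (take (pos r) w), (drop (pos r) (take (pos r') w)), (drop (pos r') w).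
rewrite catA take_pos cat_take_drop; split=> //.
by rewrite -/(m _); lia.
Qed.

Lemma foldl_loop q a b n : foldl step q (a ++ b) = foldl step q a ->
  foldl step q (a ++ flatten (nseq n b)) = foldl step q a.
Proof.
rewrite !foldl_cat => loop_b.
by elim: n => //= n IH; rewrite foldl_cat loop_b.
Qed.

End Loops.

(** * Rows and columns under the action *)

Definition is_x (g : gen) := if g is gx then true else false.
Definition is_z (g : gen) := if g is (gz | gz') then true else false.

Definition row (s : pT) : nat := if s is Some p then p.1 else 0.

(** Set to 0 off row [r]: a row is entered from another one only by [gx], at column 0, so growth
    stays bounded by one per generator. *)
Definition column_in (r : nat) (s : pT) : nat :=
  if s is Some (a, b) then if a == r then absz b else 0 else 0.

Lemma free_act_Omega e : free_act gen_act None e = None.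
Proof. by elim: e. Qed.

Lemma row_gen_act s g : row (gen_act s g) <= row s + 1.
Proof.
by case: s => [[a b]|] //; case: g => /=; do ?case: ifP => //= _; lia.
Qed.

Lemma column_in_gen_act r s g :
  column_in r (gen_act s g) <= column_in r s + 1.
Proof.
case: s => [[a b]|] //.
by case: g => /=; repeat (case: ifP => //= _); lia.
Qed.

Lemma free_act_step (mu : pT -> nat) l s e :
    (forall s g, mu (gen_act s g) <= mu s + 1) -> size e <= l ->
  mu (free_act gen_act s e) <= mu s + l.
Proof.
move=> mu1; elim: e s l => [|g e IH] s [|l] //= le_l; rewrite ?leq_addr //.
apply: leq_trans (IH _ _ le_l) _.
by rewrite addnS -addSn leq_add2r -addn1.
Qed.

(** Only [gx] changes the row of a surviving point, and Omega is absorbing. *)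
Lemma row_free_act s e : free_act gen_act s e <> None ->
  row (free_act gen_act s e) = row s + count is_x e.
Proof.
elim: e s => [|g e IH] s /=; first by rewrite addn0.
move=> nO; rewrite IH //; case: s nO => [[a b]|]; last first.
  by rewrite free_act_Omega.
by case: g => /=; repeat (case: ifP => //= _); rewrite ?free_act_Omega //; lia.
Qed.

(** In such a row [gx], [gy] and [gy'] kill every column but 0, hence one of two distinct entries;
    [gz] and [gz'] keep them distinct. *)
Lemma pow2_row_all_z r c c' e : pow2 r -> c <> c' ->
    free_act gen_act (Some (r, c)) e <> None ->
    free_act gen_act (Some (r, c')) e <> None ->
  all is_z e.
Proof.
move=> r2; elim: e c c' => [|g e IH] c c' //= cc'.
case: g; rewrite /= ?r2 /=.
1-3: by case: eqP => [c0|_]; case: eqP => [c0'|_];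
        rewrite ?free_act_Omega // => _ _; case: cc'; rewrite c0 c0'.
all: by apply: IH; lia.
Qed.

Lemma all_z_fix s e : all is_z e -> (s = None \/ ~~ pow2 (row s)) ->
  free_act gen_act s e = s.
Proof.
move=> + [->|]; first by rewrite free_act_Omega.
case: s => [[r c]|] /= + nr; last by rewrite free_act_Omega.
by elim: e => //= -[] e IH //= /IH; rewrite nr.
Qed.

Lemma pow2_mul_odd k m : 0 < m -> ~~ pow2 (2 ^ k * (1 + 2 * m)).
Proof.
move=> m0; apply/negP => /pow2P[e eq_e].
have dvd : 1 + 2 * m %| 2 ^ e by rewrite -eq_e dvdn_mull.
have cop : coprime (1 + 2 * m) (2 ^ e).
  by rewrite coprimeXr // coprimen2 oddD oddM.
by move: (gcdn_idPl dvd); rewrite (eqP cop); lia.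
Qed.

(** * Values of words over a finite set of letters *)

Section Words.

Variable A : {fset FT}.

Definition in_F (a : A) : bool := if val a is inl _ then true else false.
(* Junk value: letters in T are read as the empty word. *)
Definition letter_word (a : A) : seq gen := if val a is inl m then m else [::].
Definition spell (v : seq A) : seq gen := flatten (map letter_word v).
Definition letter_act (s : pT) (a : A) : pT :=
  free_act gen_act s (letter_word a).

Lemma spell_cat v v' : spell (v ++ v') = spell v ++ spell v'.
Proof. by rewrite /spell map_cat flatten_cat. Qed.

Lemma foldl_letter_act s v :
  foldl letter_act s v = free_act gen_act s (spell v).
Proof.
by elim: v s => //= a v IH s; rewrite IH /free_act /spell /= foldl_cat.
Qed.

Lemma word_value_rcons (w : seq A) (a : A) :
  word_value (rcons w a) = (word_value w * val a)%g.
Proof. by rewrite /word_value big_rcons. Qed.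

(** A letter in T absorbs everything to its left. *)
Lemma word_value_in_F u (a : A) t v : val a = inr t -> all in_F v ->
  word_value (u ++ a :: v) = inr (free_act gen_act t (spell v)).
Proof.
move=> at_; elim/last_ind: v => [_|v b IH].
  by rewrite cats1 word_value_rcons at_; case: (word_value u).
rewrite all_rcons => /andP[bF /IH v_val].
rewrite -rcons_cons -rcons_cat word_value_rcons v_val -cats1 spell_cat.
have -> : spell [:: b] = letter_word b by apply: cats0.
rewrite /free_act foldl_cat /letter_word.
by move: bF; rewrite /in_F; case: (val b) => [m|//] _.
Qed.

Lemma last_T_letter (w : seq A) (s : pT) : word_value w = (inr s : FT) ->
  exists u a t v, [/\ w = u ++ a :: v, val a = inr t & all in_F v].
Proof.
elim/last_ind: w s => [|w b IH] s; first by rewrite /word_value big_nil.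
rewrite word_value_rcons; case eb: (val b) => [m|t] w_val; last first.
  by exists w, b, t, [::]; rewrite cats1.
case ew: (word_value w) w_val => [//|s'] _.
have [u [a [t [v [-> at_ vF]]]]] := IH _ ew.
exists u, a, t, (rcons v b); rewrite rcons_cat; split=> //.
by rewrite all_rcons vF /in_F eb.
Qed.

End Words.

Theorem proposition3p2 : ~ admits_regular_cross_section FT.
Proof.
case=> A [L [_ [D LD] crossL]].
pose l := \max_(a : A) size (letter_word a).
pose K := \max_(a : A) (if val a is inr t then row t else 0).
have le_l (a : A) : size (letter_word a) <= l.
  exact: (leq_bigmax (F := fun a : A => size (letter_word a))).
(* Row [2 ^ k] then lies above the row of every letter in T, by enough to pump on the row. *)
pose k := K + #|dfa_state D| * l.
have lt_k : k < 2 ^ k by apply: ltn_expl.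
have pow2_k : pow2 (2 ^ k) by apply/pow2P; exists k.
have [w [[Lw w_val] _]] :=
  crossL (inr (Some (2 ^ k, Posz (#|dfa_state D| * l).+1))).
have [u [a0 [t [v [ew a0t vF]]]]] := last_T_letter w_val.
(* Uniqueness of representatives, with the common prefix cancelled. *)
have run_inj v1 v2 : all (@in_F A) v1 -> all (@in_F A) v2 ->
    dfa_accept D (u ++ a0 :: v1) -> dfa_accept D (u ++ a0 :: v2) ->
    free_act gen_act t (spell v1) = free_act gen_act t (spell v2) -> v1 = v2.
  move=> F1 F2 /LD L1 /LD L2 eq12.
  have [w0 [_ uniq_w]] := crossL (inr (free_act gen_act t (spell v1))).
  have := uniq_w _ (conj L1 (word_value_in_F u a0t F1)).
  rewrite eq12 in uniq_w.
  have -> := uniq_w _ (conj L2 (word_value_in_F u a0t F2)).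
  by move/eqP; rewrite eqseq_cat // eqxx eqseq_cons eqxx => /eqP.
have row_t : row t <= K.
  have := leq_bigmax (F := fun a : A => if val a is inr t then row t else 0) a0.
  by rewrite a0t.
pose q := foldl (@dfa_trans A D) (dfa_init D) (rcons u a0).
have acceptE v' : dfa_accept D (u ++ a0 :: v')
    = (foldl (@dfa_trans A D) q v' \in dfa_final D).
  by rewrite /dfa_accept -cat_rcons foldl_cat.
have tv : free_act gen_act t (spell v)
    = Some (2 ^ k, Posz (#|dfa_state D| * l).+1).
  by move: w_val; rewrite ew (word_value_in_F u a0t vF) => -[].
have /LD := Lw; rewrite ew acceptE => acc_v.
have col_t : column_in (2 ^ k) t <= 0.
  case: (t) row_t => [[r c]|] //=; case: eqP => // ->.
  by rewrite leqNgt (leq_ltn_trans _ lt_k) ?leq_addr.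
have col_step s (a : A) :
    column_in (2 ^ k) (letter_act s a) <= column_in (2 ^ k) s + l.
  exact: free_act_step (column_in_gen_act _) (le_l a).
have row_step s (a : A) : row (letter_act s a) <= row s + l.
  exact: free_act_step row_gen_act (le_l a).
have [] := exists_growing_loop (@dfa_trans A D) col_step q (w := v) col_t.
  by rewrite foldl_letter_act tv /= eqxx.
move=> a [c [d [ev loop_c]]]; rewrite !foldl_letter_act spell_cat.
rewrite /free_act foldl_cat -!/(free_act _ _ _).
set s := free_act gen_act t (spell a) => col_s col_sc.
case es: s col_s col_sc => [[r i]|] //=; case: eqP => // er.
rewrite {}er in es * => i0.
case esc: (free_act _ _ _) => [[r' j]|] //=; case: eqP => // er' ij.
rewrite {}er' in esc; rewrite {}ev in vF acc_v tv.
move: vF; rewrite !all_cat => /and3P[aF cF dF].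
have c0 : c <> [::].
  by move=> c0; move: esc ij; rewrite c0 => -[->]; lia.
have acc_pump a' n : foldl (@dfa_trans A D) q a' = foldl (@dfa_trans A D) q a ->
    dfa_accept D (u ++ a0 :: a' ++ flatten (nseq n c) ++ d).
  move=> eq_a'; rewrite acceptE catA foldl_cat foldl_loop.
    by rewrite eq_a'; move: acc_v; rewrite catA foldl_cat loop_c.
  by move: loop_c; rewrite !foldl_cat eq_a'.
have pumpF a' n : all (@in_F A) a' ->
    all (@in_F A) (a' ++ flatten (nseq n c) ++ d).
  move=> a'F; rewrite !all_cat a'F dF andbT /=.
  by elim: n => //= n IH; rewrite all_cat cF.
have pump_neq a' n :
    a' ++ flatten (nseq n c) ++ d <> a' ++ flatten (nseq n.+1 c) ++ d.
  move/(congr1 size); rewrite /= !size_cat.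
  by case: (c) c0 => //= *; lia.
have act_pump a' n : free_act gen_act t (spell (a' ++ flatten (nseq n c) ++ d))
    = free_act gen_act (iter n (free_act gen_act ^~ (spell c))
        (free_act gen_act t (spell a'))) (spell d).
  rewrite !spell_cat /free_act !foldl_cat; congr foldl.
  elim: n (foldl _ t _) => //= n IH s1.
  by rewrite spell_cat foldl_cat IH -iterSr.
(* Otherwise [n] and [n.+1] copies of [c] would give two accepted words with the same value. *)
have pump_false a' n : all (@in_F A) a' ->
    foldl (@dfa_trans A D) q a' = foldl (@dfa_trans A D) q a ->
    iter n (free_act gen_act ^~ (spell c)) (free_act gen_act t (spell a'))
    <> iter n.+1 (free_act gen_act ^~ (spell c))
         (free_act gen_act t (spell a')).
  move=> a'F eq_a' eq_it; apply: (@pump_neq a' n); apply: run_inj.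
  - exact: pumpF.
  - exact: pumpF.
  - exact: acc_pump.
  - exact: acc_pump.
  - by rewrite !act_pump eq_it.
have z_c : all is_z (spell c).
  apply: (@pow2_row_all_z (2 ^ k) i j) => //; first by move=> eij; lia.
    by rewrite -/(free_act _ _ _) esc.
  (* Two copies of [c] already lead to Omega, and a third stays there. *)
  move=> sccO; apply: (@pump_false a 2) => //=.
  by rewrite -/s es esc sccO free_act_Omega.
have [] := exists_growing_loop (@dfa_trans A D) row_step q (w := a) row_t.
  by rewrite foldl_letter_act -/s es.
move=> a1 [a2 [a3 [ea loop_a2 _]]].
rewrite !foldl_letter_act => row_lt.
(* [row] is 0 at Omega, which the strict growth excludes. *)
have nO2 : free_act gen_act t (spell (a1 ++ a2)) <> None.
  by move=> eO; move: row_lt; rewrite eO.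
have nO1 : free_act gen_act t (spell a1) <> None.
  move=> eO; move: nO2; rewrite spell_cat /free_act foldl_cat.
  by rewrite -/(free_act _ t _) eO -/(free_act _ _ _) free_act_Omega.
move: row_lt; rewrite !row_free_act // spell_cat count_cat => row_lt.
(* [j0] is made opaque, so that [nseq j0.+1 a2] is not unfolded below. *)
have [j0 ej0] : exists j0, j0 = 2 * 2 ^ k by eexists.
(* [a] contains one copy of [a2], so [j0] are added; with [m] the number of [gx] in [a2], the row
   rises by [2 * 2 ^ k * m]. *)
pose a' := a1 ++ flatten (nseq j0.+1 a2) ++ a3.
apply: (@pump_false a' 0) => /=.
- move: aF; rewrite ea !all_cat => /and3P[-> a2F ->]; rewrite a2F andbT /=.
  by elim: (j0) => //= n IH; rewrite all_cat a2F.
- rewrite /a' catA foldl_cat foldl_loop // ea.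
  by rewrite catA [RHS]foldl_cat loop_a2.
apply/esym/all_z_fix => //.
case ea': (free_act gen_act t (spell a')) => [p|]; [right|by left].
have : row s = 2 ^ k by rewrite es.
rewrite -ea' row_free_act ?ea' // /s row_free_act -/s ?es //.
rewrite ea /a' !spell_cat !count_cat.
have -> n : count is_x (spell (flatten (nseq n a2)))
    = n * count is_x (spell a2).
  by elim: n => //= n IH; rewrite spell_cat count_cat IH mulSn.
move=> row_s.
have /(pow2_mul_odd k) : 0 < count is_x (spell a2) by lia.
congr (~~ pow2 _); rewrite mulnDr muln1 mulnA [2 ^ k * 2]mulnC -ej0.
by rewrite -row_s; lia.
Qed.
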